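(* Let $\mathit{init}$, $\mathit{env}$, $\mathit{ctrl}$, $\mathit{plant}$, $\mathit{guarantee}$ be given, over the real-valued variables $x, v, x_c, a_n, a_s, \tau$ and the real symbolic parameters $a_s^{\min}, a_n^{\min}, a_n^{\max}, T$ (never modified by the programs), by $$\mathit{guarantee} \equiv (x \ge x_c \to v = 0),$$ $$\mathit{plant} \equiv \tau := 0;\ \{x' = v,\ v' = a_s,\ \tau' = 1\ \&\ v \ge 0 \land \tau \le T\},$$ $$\mathit{ctrl} \equiv \text{if } (x_c - x \ge \mathrm{msd}(T))\ \ a_s := a_n\ \ \text{else}\ \ a_s := -a_s^{\min},$$ $$\mathrm{msd}(t) \equiv vt + \frac{a_n^{\max} t^2}{2} + \frac{(v + a_n^{\max} t)^2}{2 a_s^{\min}},$$ $$\mathit{env} \equiv x_c := *;\ ?(x_c - x \ge \mathrm{msd}(0));\ a_n := *;\ ?(-a_n^{\min} \le a_n \le a_n^{\max}),$$ $$\mathit{init} \equiv a_s^{\min} > 0 \land a_n^{\max} > 0 \land a_n^{\min} > 0 \land T > 0 \land v \ge 0 \land x_c - x \ge \mathrm{msd}(0).$$ Then the differential dynamic logic formula $$\mathit{init} \to [(\mathit{env};\ \mathit{ctrl};\ \mathit{plant})^*]\,\mathit{guarantee}$$ is valid; that is, for every state satisfying $\mathit{init}$, every state reachable from it by executing the hybrid program $(\mathit{env};\mathit{ctrl};\mathit{plant})^*$ satisfies $\mathit{guarantee}$.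
   Context: Interpretation: a vehicle has position $x$ and velocity $v$; $x_c$ is a critical position supplied by the environment (the critical velocity being $0$); $a_n$ is the nominal requested acceleration; $a_s$ is the acceleration issued by the safety controller; $T$ is the maximal sampling time; $a_n^{\min}, a_n^{\max}, a_s^{\min}$ are positive acceleration/braking bounds. Hybrid programs and semantics. A state is a map from variables to $\mathbb{R}$. Each hybrid program $\alpha$ denotes a reachability relation $\rho(\alpha)$ on states: - $y := e$: the value of $y$ becomes the current value of the term $e$, all other variables unchanged. - $y := *$: the value of $y$ becomes an arbitrary real number, all other variables unchanged. - $?P$: relates a state to itself if $P$ holds there; otherwise the run aborts (no successor state). - $\{y' = f(y)\ \&\ Q\}$: relates $s$ to $s'$ if for some duration $d \ge 0$ there is a solution of the differential equation system on $[0,d]$ starting at $s$, ending at $s'$, such that $Q$ holds at all times in $[0,d]$; variables not in the system are unchanged. - $\alpha;\beta$: sequential composition. $\alpha \cup \beta$: nondeterministic choice (union of relations). - $\text{if }(P)\ \alpha\ \text{else}\ \beta$ abbreviates $(?P;\alpha)\cup(?\neg P;\beta)$. - $\alpha^*$: $\alpha$ repeated any finite number $n \ge 0$ of times (reflexive transitive closure). The formula $[\alpha]\phi$ holds in $s$ iff $\phi$ holds in every $s'$ with $(s,s')\in\rho(\alpha)$. A formula is valid if it holds in all states. The expression $\mathrm{msd}(t)$ is always evaluated with the current values of the variables occurring in it. *)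

(* Defs.v *)
From Stdlib Require Import Reals List Relations.
Open Scope R_scope.

(** Differential dynamic logic over a type [V] of variables.  Terms and
    formulas are represented by their values in a state; symbolic parameters
    are variables that no program writes to. *)

Definition state (V : Type) : Type := V -> R.
Definition term (V : Type) : Type := state V -> R.
Definition formula (V : Type) : Type := state V -> Prop.

Inductive hp (V : Type) : Type :=
| Assign (y : V) (e : term V)
| AssignAny (y : V)
| Test (P : formula V)
| Evolve (sys : list (V * term V)) (Q : formula V)
| Seq (a b : hp V)
| Choice (a b : hp V)
| Star (a : hp V).

Arguments Assign {V} y e.
Arguments AssignAny {V} y.
Arguments Test {V} P.
Arguments Evolve {V} sys Q.
Arguments Seq {V} a b.
Arguments Choice {V} a b.
Arguments Star {V} a.

Notation "a ;; b" := (Seq a b) (at level 60, right associativity).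

Definition IfElse {V : Type} (P : formula V) (a b : hp V) : hp V :=
  Choice (Test P ;; a) (Test (fun s => ~ P s) ;; b).

(** [phi] solves the system on [[0, d]] from [s].  [D_in] is the derivative
    relative to [[0, d]]: one-sided at the endpoints, and no constraint when
    [d = 0]. *)
Definition solves {V : Type} (sys : list (V * term V)) (d : R)
    (phi : R -> state V) (s : state V) : Prop :=
  phi 0 = s /\
  forall t : R, 0 <= t <= d ->
    (forall (y : V) (e : term V), In (y, e) sys ->
       D_in (fun u => phi u y) (fun u => e (phi u)) (fun u => 0 <= u <= d) t) /\
    (forall z : V, ~ In z (map fst sys) -> phi t z = s z).

Fixpoint rho {V : Type} (a : hp V) (s s' : state V) : Prop :=
  match a with
  | Assign y e => s' y = e s /\ forall z, z <> y -> s' z = s z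
  | AssignAny y => forall z, z <> y -> s' z = s z
  | Test P => s' = s /\ P s
  | Evolve sys Q =>
      exists (d : R) (phi : R -> state V),
        0 <= d /\ solves sys d phi s /\ phi d = s' /\
        forall t, 0 <= t <= d -> Q (phi t)
  | a1 ;; a2 => exists m, rho a1 s m /\ rho a2 m s'
  | Choice a1 a2 => rho a1 s s' \/ rho a2 s s'
  | Star a1 => clos_refl_trans (state V) (rho a1) s s'
  end.

Definition box {V : Type} (a : hp V) (P : formula V) : formula V :=
  fun s => forall s', rho a s s' -> P s'.

Definition valid {V : Type} (P : formula V) : Prop := forall s, P s.

(** The vehicle. *)

Inductive var : Type :=
| x | v | x_c | a_n | a_s | tau
| a_s_min | a_n_min | a_n_max | T.

Definition msd (t : term var) : term var := fun s =>
  s v * t s + s a_n_max * (t s) ^ 2 / 2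
  + (s v + s a_n_max * t s) ^ 2 / (2 * s a_s_min).

Definition guarantee : formula var := fun s => s x >= s x_c -> s v = 0.

Definition plant : hp var :=
  Assign tau (fun _ => 0) ;;
  Evolve ((x, fun s => s v) :: (v, fun s => s a_s) :: (tau, fun _ => 1) :: nil)
         (fun s => s v >= 0 /\ s tau <= s T).

Definition ctrl : hp var :=
  IfElse (fun s => s x_c - s x >= msd (fun s => s T) s)
    (Assign a_s (fun s => s a_n))
    (Assign a_s (fun s => - s a_s_min)).

Definition env : hp var :=
  AssignAny x_c ;;
  Test (fun s => s x_c - s x >= msd (fun _ => 0) s) ;;
  AssignAny a_n ;;
  Test (fun s => - s a_n_min <= s a_n <= s a_n_max).

Definition init : formula var := fun s =>
  s a_s_min > 0 /\ s a_n_max > 0 /\ s a_n_min > 0 /\ s T > 0 /\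
  s v >= 0 /\ s x_c - s x >= msd (fun _ => 0) s.

(* Main.v *)
Require Import Defs.
From Stdlib Require Import Reals List Relations.
From Stdlib Require Import Lra.
Open Scope R_scope.

(** The invariant is that full braking from the current state stops the
    vehicle at or before [x_c], i.e. [x + v^2 / (2 a_s_min) <= x_c].  While
    braking, [x + v^2 / (2 a_s_min)] is conserved.  While accelerating, the
    motion is explicitly polynomial in time, and the duration is at most [T]
    because [tau] is a clock; the test in [ctrl] bounds the worst case. *)

Lemma D_in_zero_constant (f : R -> R) (d : R) :
  0 <= d ->
  (forall t, 0 <= t <= d -> D_in f (fun _ => 0) (fun u => 0 <= u <= d) t) ->
  forall t, 0 <= t <= d -> f t = f 0.
Proof.
intros Hd Df t Ht.
(* Precomposing with the projection onto [[0, d]] turns one-sided continuity at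
   the endpoints into the two-sided continuity that the mean value theorem of
   the library asks for. *)
pose (p := fun u => Rmax 0 (Rmin u d)).
assert (p_range : forall u, 0 <= p u <= d).
{ intro u; unfold p, Rmax, Rmin; repeat destruct (Rle_dec _ _); lra. }
assert (p_id : forall u, 0 <= u <= d -> p u = u).
{ intros u Hu; unfold p, Rmax, Rmin; repeat destruct (Rle_dec _ _); lra. }
(* The projection is 1-Lipschitz, so a modulus of continuity for [f] on [[0, d]] serves unchanged
   for [f] composed with [p]. *)
assert (p_lip : forall u w, Rabs (p u - p w) <= Rabs (u - w)).
{ intros u w; unfold p, Rmax, Rmin, Rabs;
  repeat destruct (Rle_dec _ _); repeat destruct (Rcase_abs _); lra. }
assert (Cg : forall u, continuity_pt (fun w => f (p w)) u).
{ intros u eps Heps.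
  destruct (cont_deriv _ _ _ _ (Df _ (p_range u)) eps Heps) as [alp [Halp H]].
  exists alp; split; [exact Halp|].
  intros w [_ Hw]; simpl in Hw |- *.
  (* The limit behind [D_in] is punctured and says nothing at the base point, but there the two
     values of [f] coincide. *)
  destruct (Req_dec (p u) (p w)) as [E|N].
  - rewrite E, Rdist_eq; exact Heps.
  - apply H; split; [split; [apply p_range | exact N]|].
    simpl; unfold Rdist in *.
    apply Rle_lt_trans with (2 := Hw), p_lip. }
assert (Dg : forall u, 0 < u < d -> derivable_pt_lim (fun w => f (p w)) u 0).
{ intros u Hu eps Heps.
  destruct (Df u (conj (Rlt_le _ _ (proj1 Hu)) (Rlt_le _ _ (proj2 Hu)))
              eps Heps) as [alp [Halp H]].
  (* Increments below this bound keep [u + h] inside [[0, d]], where [p] is the identity. *)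
  assert (Hm : 0 < Rmin alp (Rmin u (d - u))).
  { repeat apply Rmin_glb_lt; lra. }
  exists (mkposreal _ Hm); intros h Hh0 Hh; simpl in Hh.
  pose proof (Rmin_l alp (Rmin u (d - u))).
  pose proof (Rmin_r alp (Rmin u (d - u))).
  pose proof (Rmin_l u (d - u)).
  pose proof (Rmin_r u (d - u)).
  assert (Hin : 0 <= u + h <= d).
  { unfold Rabs in Hh; destruct (Rcase_abs h); lra. }
  rewrite (p_id (u + h)), (p_id u) by lra.
  specialize (H (u + h)); simpl in H; unfold Rdist in H.
  replace (u + h - u) with h in H by ring.
  apply H; split; [split; lra | lra]. }
assert (pr : forall u, 0 < u < d -> derivable_pt (fun w => f (p w)) u).
{ intros u Hu; exists 0; exact (Dg u Hu). }
pose proof (null_derivative_loc _ 0 d pr (fun u _ => Cg u)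
  (fun u Hu => derive_pt_eq_0 _ _ _ (pr u Hu) (Dg u Hu))) as C.
specialize (C t Ht); simpl in C.
rewrite !p_id in C by lra; exact C.
Qed.

(** Apply constancy to [f - g]. This stands in for uniqueness of solutions: a component of a flow is
    compared with an explicit polynomial that has the same derivative. *)
Lemma D_in_eq_increment (f g df dg : R -> R) (d : R) :
  0 <= d ->
  (forall t, 0 <= t <= d -> df t = dg t) ->
  (forall t, 0 <= t <= d -> D_in f df (fun u => 0 <= u <= d) t) ->
  (forall t, 0 <= t <= d -> D_in g dg (fun u => 0 <= u <= d) t) ->
  forall t, 0 <= t <= d -> f t - f 0 = g t - g 0.
Proof.
intros Hd E Df Dg t1 Ht1.
enough (f t1 - g t1 = f 0 - g 0) by lra.
apply (D_in_zero_constant (fun t => f t - g t) d Hd); [|exact Ht1].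
intros t Ht.
pose proof (Dminus _ _ _ _ _ t (Df t Ht) (Dg t Ht)) as D.
unfold D_in in D |- *; rewrite E, Rminus_diag in D by exact Ht; exact D.
Qed.

Lemma plant_constant (s s' : state var) (z : var) :
  z <> x -> z <> v -> z <> tau -> rho plant s s' -> s' z = s z.
Proof.
intros Hx Hv Ht [m [[_ Hm] [d [phi [Hd [[_ Hphi] [<- _]]]]]]].
rewrite (proj2 (Hphi d (conj Hd (Rle_refl d))) z).
- apply Hm; exact Ht.
- simpl; intuition congruence.
Qed.

(** The system is triangular, so its components are integrated in turn: [a_s] is frozen, hence [v]
    is affine in time, hence [x] is quadratic. *)
Lemma plant_motion (s s' : state var) :
  rho plant s s' ->
  exists t, 0 <= t <= s T /\ 0 <= s' v /\
    s' v = s v + s a_s * t /\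
    s' x = s x + s v * t + s a_s * t ^ 2 / 2.
Proof.
intros H.
pose proof (plant_constant s s' T ltac:(discriminate) ltac:(discriminate)
  ltac:(discriminate) H) as HT.
destruct H as [m [[Hm0 Hm] [d [phi [Hd [[H0 Hphi] [<- HQ]]]]]]].
set (D := fun u => 0 <= u <= d) in *.
assert (Has : forall t, 0 <= t <= d -> phi t a_s = s a_s).
{ intros t Ht; rewrite (proj2 (Hphi t Ht) a_s).
  - apply Hm; discriminate.
  - simpl; intuition discriminate. }
assert (Dx' : forall t, 0 <= t <= d ->
  D_in (fun u => phi u x) (fun u => phi u v) D t).
{ intros t Ht; apply (proj1 (Hphi t Ht) x (fun s => s v)); simpl; auto. }
assert (Dv' : forall t, 0 <= t <= d ->
  D_in (fun u => phi u v) (fun u => phi u a_s) D t).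
{ intros t Ht; apply (proj1 (Hphi t Ht) v (fun s => s a_s)); simpl; auto. }
assert (Dt' : forall t, 0 <= t <= d ->
  D_in (fun u => phi u tau) (fun _ => 1) D t).
{ intros t Ht; apply (proj1 (Hphi t Ht) tau (fun _ => 1)); simpl; auto. }
assert (Hd' : 0 <= d <= d) by lra.
assert (Etau : phi d tau - phi 0 tau = d - 0).
{ apply (D_in_eq_increment (fun u => phi u tau) (fun u => u)
    (fun _ => 1) (fun _ => 1) d); auto.
  intros t _; apply Dx. }
assert (Ev : forall t, 0 <= t <= d ->
  phi t v - phi 0 v = s a_s * t - s a_s * 0).
{ apply (D_in_eq_increment (fun u => phi u v) (fun u => s a_s * u)
    (fun u => phi u a_s) (fun _ => s a_s * 1)); auto.
  - intros t Ht; rewrite Has by exact Ht; ring.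
  - intros t _; exact (Dmult_const _ _ _ _ (s a_s) (Dx D t)). }
(* The polynomial and its derivative are written as [Dadd], [Dmult_const] and [Dmult] produce them,
   so that these rules apply directly. *)
assert (Ex : phi d x - phi 0 x
             = (phi 0 v * d + s a_s / 2 * (d * d))
               - (phi 0 v * 0 + s a_s / 2 * (0 * 0))).
{ apply (D_in_eq_increment (fun u => phi u x)
    (fun u => phi 0 v * u + s a_s / 2 * (u * u)) (fun u => phi u v)
    (fun u => phi 0 v * 1 + s a_s / 2 * (1 * u + u * 1)) d); auto.
  - intros t Ht; pose proof (Ev t Ht); lra.
  - intros t _; apply Dadd; apply Dmult_const; [|apply Dmult]; apply Dx. }
pose proof (Ev d Hd') as Evd.
destruct (HQ d Hd') as [Qv Qt].
rewrite H0 in Etau, Evd, Ex.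
rewrite (Hm v ltac:(discriminate)) in Evd, Ex.
rewrite (Hm x ltac:(discriminate)) in Ex.
exists d; repeat split; lra.
Qed.

(** The sign conditions belong to the invariant because the loop induction passes nothing else from
    one round to the next. *)
Definition stoppable : formula var := fun s =>
  s a_s_min > 0 /\ s a_n_max > 0 /\ s v >= 0 /\
  s x_c - s x >= (s v) ^ 2 / (2 * s a_s_min).

Lemma msd_0 (s : state var) :
  msd (fun _ => 0) s = (s v) ^ 2 / (2 * s a_s_min).
Proof.
unfold msd; rewrite !Rmult_0_r, !Rplus_0_r; unfold Rdiv; ring.
Qed.

Lemma init_stoppable (s : state var) : init s -> stoppable s.
Proof.
intros (Hb & HA & _ & _ & Hv & Hx); rewrite msd_0 in Hx.
repeat split; assumption.
Qed.

Lemma stoppable_guarantee (s : state var) : stoppable s -> guarantee s.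
Proof.
intros (Hb & HA & Hv & Hx) Hc.
(* Past [x_c] the stopping distance is at most zero; clearing its denominator turns this into
   [(s v) ^ 2 <= 0]. *)
assert (E : (s v) ^ 2 = (s v) ^ 2 / (2 * s a_s_min) * (2 * s a_s_min))
  by (field; lra).
nra.
Qed.

Lemma env_spec (s s' : state var) :
  rho env s s' ->
  s' a_n <= s' a_n_max /\ s' x_c - s' x >= msd (fun _ => 0) s' /\
  forall z, z <> x_c -> z <> a_n -> s' z = s z.
Proof.
intros [m1 [H1 [m2 [[-> Hx] [m3 [H3 [-> [_ Ha]]]]]]]].
split; [exact Ha | split].
- unfold msd in *; rewrite !H3 by discriminate; exact Hx.
- intros z Hc Hn; rewrite H3, H1 by assumption; reflexivity.
Qed.

Lemma ctrl_spec (s s' : state var) :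
  rho ctrl s s' ->
  (s x_c - s x >= msd (fun s => s T) s /\ s' a_s = s a_n \/
   s' a_s = - s a_s_min) /\
  forall z, z <> a_s -> s' z = s z.
Proof.
intros [[m [[-> HP] [Ha Hz]]] | [m [[-> _] [Ha Hz]]]]; auto.
Qed.

(** The left side is the distance covered plus the stopping distance afterwards; the right side is
    [msd] at [T0]. The three summands compare one by one. As [a] may be negative, the squares
    compare only because the final velocity is nonnegative. *)
Lemma acceleration_bound (V A b a t T0 : R) :
  0 < b -> 0 <= V -> 0 <= A -> a <= A -> 0 <= t <= T0 -> 0 <= V + a * t ->
  V * t + a * t ^ 2 / 2 + (V + a * t) ^ 2 / (2 * b)
  <= V * T0 + A * T0 ^ 2 / 2 + (V + A * T0) ^ 2 / (2 * b).
Proof.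
intros Hb HV HA Ha Ht Hv.
assert (a * t <= A * T0) by nra.
assert (t ^ 2 <= T0 ^ 2) by (apply pow_incr; lra).
assert (0 <= t ^ 2) by (apply pow_le; lra).
assert (a * t ^ 2 <= A * T0 ^ 2) by nra.
assert (V * t <= V * T0) by nra.
assert ((V + a * t) ^ 2 / (2 * b) <= (V + A * T0) ^ 2 / (2 * b)).
{ apply Rmult_le_compat_r.
  - left; apply Rinv_0_lt_compat; lra.
  - apply pow_incr; lra. }
lra.
Qed.

Lemma stoppable_step (s s' : state var) :
  stoppable s -> rho (env ;; ctrl ;; plant) s s' -> stoppable s'.
Proof.
intros (Hb & HA & Hv & _) [m1 [He [m2 [Hc Hp]]]].
apply env_spec in He; destruct He as (Ha & Hx & He).
(* Since [env] picks a fresh [x_c], the distance inequality for this round comes from its test. *)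
rewrite msd_0 in Hx.
apply ctrl_spec in Hc; destruct Hc as (Hc & Hc').
pose proof (plant_constant _ _ a_s_min ltac:(discriminate) ltac:(discriminate)
  ltac:(discriminate) Hp) as Eb.
pose proof (plant_constant _ _ a_n_max ltac:(discriminate) ltac:(discriminate)
  ltac:(discriminate) Hp) as EA.
pose proof (plant_constant _ _ x_c ltac:(discriminate) ltac:(discriminate)
  ltac:(discriminate) Hp) as Ec.
destruct (plant_motion _ _ Hp) as (t & Ht & Hv' & Ev & Ex).
rewrite Hc' in Eb, EA, Ec, Ht by discriminate.
rewrite (Hc' v) in Ev, Ex by discriminate.
rewrite (Hc' x) in Ex by discriminate.
rewrite <- He in Hb, HA, Hv by discriminate.
unfold stoppable; rewrite Eb, EA, Ec.
split; [exact Hb | split; [exact HA | split; [lra|]]].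
destruct Hc as [[Hmsd Eas] | Eas]; rewrite Eas in Ev, Ex.
- unfold msd in Hmsd.
  assert (HV : 0 <= m1 v + m1 a_n * t) by lra.
  pose proof (acceleration_bound (m1 v) (m1 a_n_max) (m1 a_s_min) (m1 a_n) t
    (m1 T) Hb ltac:(lra) ltac:(lra) Ha Ht HV).
  rewrite Ev, Ex; lra.
(* Under braking, the loss in [v ^ 2] is [2 * a_s_min] times the distance covered. *)
- assert (s' x + (s' v) ^ 2 / (2 * m1 a_s_min)
          = m1 x + (m1 v) ^ 2 / (2 * m1 a_s_min))
    by (rewrite Ev, Ex; field; lra).
  lra.
Qed.

Theorem theorem1 :
  valid (fun s : state var =>
    init s -> box (Star (env ;; ctrl ;; plant)) guarantee s).
Proof.
intros s Hs s' H; apply stoppable_guarantee.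
(* With [Hs] back in the goal, the induction proves preservation of [stoppable], which composes
   along transitivity. *)
apply init_stoppable in Hs; revert Hs; simpl in H.
induction H as [s s' H | s | s m s' _ IH1 _ IH2]; auto.
intros Hs; exact (stoppable_step _ _ Hs H).
Qed.
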